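(* Let $p>1$ and let $G$ be a finite simple connected graph on $n\geq 4$ vertices with nonempty boundary $B(G)$. Then $$\lambda_{1,p}(G)\geq \lambda_{1,p}(T_{n,3}),$$ and equality holds if and only if $G$ is isomorphic to $T_{n,3}$.
   Context: For a finite simple connected graph $G$, its boundary is $B(G)=\{x\in V(G): \deg(x)=1\}$ (the pendant vertices) and its interior is $\Omega(G)=V(G)\setminus B(G)$; ''graph with boundary'' means $B(G)\neq\emptyset$. For $p\ge 1$, let $C_B(G)=\{f\in\mathbb{R}^{V(G)}: f|_{B(G)}\equiv 0\}$ and define the first $p$-Dirichlet eigenvalue $$\lambda_{1,p}(G)=\min_{f\in C_B(G)\setminus\{0\}}\frac{\sum_{\{x,y\}\in E(G)}|f(x)-f(y)|^p}{\sum_{x\in V(G)}|f(x)|^p}.$$ (For $p>1$ this equals the smallest $\lambda$ such that $\sum_{y\sim x}|f(x)-f(y)|^{p-2}(f(x)-f(y))=\lambda|f(x)|^{p-2}f(x)$ for all $x\in\Omega(G)$ has a nonzero solution $f\in C_B(G)$.) For $n>i\ge 3$, the tadpole graph $T_{n,i}$ is the graph on vertices $t_1,\dots,t_n$ with edges $t_n\sim t_{n-1}\sim\cdots\sim t_i\sim t_{i-1}\sim\cdots\sim t_2\sim t_1\sim t_i$, i.e. a cycle $t_i,t_{i-1},\dots,t_1$ of length $i$ (the head) with a path $t_n,\dots,t_i$ (the tail) attached at the neck vertex $t_i$; its only boundary vertex is $t_n$. *)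

(* Defs.v *)
From HB Require Import structures.
From mathcomp Require Import all_boot all_order all_algebra.
From mathcomp Require Import boolp classical_sets reals exp.
Set Implicit Arguments. Unset Strict Implicit. Unset Printing Implicit Defensive.
Import Order.TTheory GRing.Theory Num.Theory.
Local Open Scope ring_scope.
Local Open Scope classical_set_scope.

(* A finite simple graph: vertex type T : finType, adjacency e : rel T,
   assumed symmetric and irreflexive in the theorem. *)

Definition deg (T : finType) (e : rel T) (x : T) : nat := #|[pred y | e x y]|.

Definition boundary (T : finType) (e : rel T) : pred T := [pred x | deg e x == 1%N].

Definition CB_nonzero (R : realType) (T : finType) (e : rel T) : set (T -> R) :=
  [set f | (forall x, x \in boundary e -> f x = 0) /\ exists x, f x != 0].

(* sum over (unordered) edges {x,y} of |f x - f y|^p: each edge is counted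
   twice in the ordered double sum, hence the factor 1/2. *)
Definition edge_energy (R : realType) (T : finType) (e : rel T) (p : R) (f : T -> R) : R :=
  (\sum_(x : T) \sum_(y : T | e x y) powR `|f x - f y| p) / 2.

Definition vertex_mass (R : realType) (T : finType) (p : R) (f : T -> R) : R :=
  \sum_(x : T) powR `|f x| p.

Definition rayleigh (R : realType) (T : finType) (e : rel T) (p : R) (f : T -> R) : R :=
  edge_energy e p f / vertex_mass p f.

(* first p-Dirichlet eigenvalue: the minimum (here: infimum, which is attained)
   of the Rayleigh quotient over nonzero f vanishing on the boundary *)
Definition lambda1p (R : realType) (T : finType) (e : rel T) (p : R) : R :=
  inf [set rayleigh e p f | f in @CB_nonzero R T e].

(* Tadpole graph T_{n,i} on vertices 'I_n, where index k stands for t_{k+1}: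
   path edges t_{k} ~ t_{k+1} (indices k, k+1) and the extra edge t_1 ~ t_i
   (indices 0 and i-1). *)
Definition tadpole (n i : nat) : rel 'I_n :=
  fun a b => [|| (a.+1 == b :> nat), (b.+1 == a :> nat),
                ((a == 0 :> nat) && (b == i.-1 :> nat)) |
                ((b == 0 :> nat) && (a == i.-1 :> nat))].

Definition graph_iso (T1 T2 : finType) (e1 : rel T1) (e2 : rel T2) : Prop :=
  exists f : T1 -> T2, bijective f /\ forall x y, e2 (f x) (f y) = e1 x y.
Arguments tadpole : clear implicits.

(* Main.v *)
(* Rearrange |f| on G nonincreasingly as h 0 >= h 1 >= ... >= h (n - 1) = 0 and
   put these values on the tadpole, the two largest on the free end of the head.
   Since x^p is superadditive, an edge of G pays at least for the part of its
   drop above the level h 2 plus all the elementary steps below it. Every cut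
   below h 2 is crossed by an edge because G is connected, and the two top
   vertices are interior, hence of degree at least 2, which pays for the
   triangle. So the tadpole has at most the Rayleigh quotient of f.

   In the equality case take f minimising on G; then h minimises on the tadpole,
   and this forces h to be strictly decreasing from vertex 1 on. Superadditivity
   being strict, every edge of G is an edge of the tadpole, and connectedness
   together with the degrees of the top vertices gives all of them. *)
Require Import Defs.
From HB Require Import structures.
From mathcomp Require Import all_boot all_order all_algebra.
From mathcomp Require Import boolp classical_sets reals exp.
From mathcomp Require Import topology normedtype derive.
From mathcomp Require Import zify ring lra.
Set Implicit Arguments.
Unset Strict Implicit.
Unset Printing Implicit Defensive.
Import Order.TTheory GRing.Theory Num.Theory.
Import numFieldNormedType.Exports.
Local Open Scope ring_scope.

(** * Superadditivity and continuity of real powers *)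

Lemma powRB1_split (R : realType) (p x : R) :
  1 < p -> 0 <= x -> x `^ p = x * x `^ (p - 1).
Proof. by move=> p1 x0; rewrite mulr_powRB1// (lt_trans _ p1). Qed.

(** Both sides are [x + t] times a power of exponent [p - 1], which is monotone in its base. This
    gives the first-order gain in mass of a small perturbation. *)
Lemma powR_bernoulli (R : realType) (p x t : R) :
  1 < p -> 0 <= x -> 0 <= t -> x `^ p + t * x `^ (p - 1) <= (x + t) `^ p.
Proof.
move=> p1 x0 t0; rewrite !(powRB1_split p1) ?addr_ge0// -mulrDl.
rewrite ler_wpM2l ?addr_ge0//.
by apply: ge0_ler_powR; rewrite ?subr_ge0 ?(ltW p1) ?nnegrE ?addr_ge0 ?lerDl.
Qed.

Lemma powR_superadditive (R : realType) (p x y : R) :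
  1 < p -> 0 <= x -> 0 <= y -> x `^ p + y `^ p <= (x + y) `^ p.
Proof.
move=> p1 x0 y0; rewrite !(powRB1_split p1) ?addr_ge0// mulrDl.
by apply: lerD; rewrite ler_wpM2l//; apply: ge0_ler_powR;
  rewrite ?subr_ge0 ?(ltW p1) ?nnegrE ?addr_ge0 ?lerDl ?lerDr.
Qed.

Lemma powR_strictly_superadditive (R : realType) (p x y : R) :
  1 < p -> 0 < x -> 0 < y -> x `^ p + y `^ p < (x + y) `^ p.
Proof.
move=> p1 x0 y0; rewrite !(powRB1_split p1) ?addr_ge0 ?(ltW x0) ?(ltW y0)// mulrDl.
by apply: ltrD; rewrite ltr_pM2l//; apply: gt0_ltr_powR;
  rewrite ?subr_gt0 ?nnegrE ?addr_ge0 ?(ltW x0) ?(ltW y0) ?ltrDl ?ltrDr.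
Qed.

Lemma powR_sum_superadditive (R : realType) (p : R) (I : Type) (r : seq I)
    (P : pred I) (F : I -> R) :
  1 < p -> (forall i, P i -> 0 <= F i) ->
  \sum_(i <- r | P i) F i `^ p <= (\sum_(i <- r | P i) F i) `^ p.
Proof.
move=> p1 F0.
have p0 : p != 0 by rewrite gt_eqF// (lt_trans _ p1).
suff: 0 <= \sum_(i <- r | P i) F i /\
      \sum_(i <- r | P i) F i `^ p <= (\sum_(i <- r | P i) F i) `^ p by case.
elim/big_rec2: _ => [|i y x Pi [x0 yx]]; first by rewrite powR0.
split; first by rewrite addr_ge0// F0.
by apply: le_trans (powR_superadditive p1 (F0 _ Pi) x0); rewrite lerD2l.
Qed.

Lemma norm_powR_continuous (R : realType) (p : R) :
  0 < p -> continuous (fun x : R => `|x| `^ p).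
Proof.
(* The derivative of the power is available only away from 0. At 0 continuity is checked by hand:
   [|y|] below the [p]-th root of [eps] suffices. *)
move=> p0 x; have [->|x0] := eqVneq x 0.
  rewrite /continuous_at normr0 powR0 ?gt_eqF//.
  apply/cvgrPdist_lt => eps e0; near=> y.
  rewrite sub0r normrN ger0_norm ?powR_ge0//.
  have -> : eps = (eps `^ p^-1) `^ p by rewrite -powRrM mulVf ?powRr1 ?gt_eqF// ltW.
  apply: gt0_ltr_powR; rewrite ?nnegrE ?powR_ge0//.
  rewrite -[y]subr0 distrC; near: y.
  by apply: (@cvgr_dist_lt _ R^o); [exact: cvg_id|rewrite powR_gt0].
apply: (@continuous_comp _ _ _ (fun x : R => `|x|) (fun x : R => x `^ p)).
  exact: norm_continuous.
apply: differentiable_continuous; apply/derivable1_diffP.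
by apply: derivable_powR; rewrite in_itv/= andbT normr_gt0.
Unshelve. all: by end_near. Qed.

(** * Rayleigh quotients and existence of a minimiser *)

Lemma vertex_mass_gt0 (R : realType) (T : finType) (p : R) (f : T -> R) :
  (exists x, f x != 0) -> 0 < vertex_mass p f.
Proof.
move=> [x fx]; rewrite /vertex_mass (bigD1 x)//= ltr_pwDl//.
  by rewrite powR_gt0 // normr_gt0.
by apply: sumr_ge0 => y _; exact: powR_ge0.
Qed.

Lemma edge_energy_ge0 (R : realType) (T : finType) (e : rel T) (p : R)
  (f : T -> R) : 0 <= edge_energy e p f.
Proof.
by apply: divr_ge0 => //; do 2! [apply: sumr_ge0 => ? _]; exact: powR_ge0.
Qed.

Lemma lambda1p_le_rayleigh (R : realType) (T : finType) (e : rel T) (p : R)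
  (f : T -> R) : CB_nonzero e f -> lambda1p e p <= rayleigh e p f.
Proof.
move=> fCB; apply: ge_inf; last by exists f.
exists 0 => _ [g [_ g0] <-].
by rewrite divr_ge0 ?edge_energy_ge0// ltW ?vertex_mass_gt0.
Qed.

Lemma edge_energyZ (R : realType) (T : finType) (e : rel T) (p c : R)
    (f : T -> R) :
  edge_energy e p (fun x => c * f x) = `|c| `^ p * edge_energy e p f.
Proof.
rewrite /edge_energy mulrA; congr (_ / _).
rewrite big_distrr; apply: eq_bigr => x _; rewrite big_distrr.
by apply: eq_bigr => y _ /=; rewrite -mulrBr normrM powRM.
Qed.

Lemma vertex_massZ (R : realType) (T : finType) (p c : R) (f : T -> R) :
  vertex_mass p (fun x => c * f x) = `|c| `^ p * vertex_mass p f.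
Proof.
by rewrite /vertex_mass big_distrr; apply: eq_bigr => x _; rewrite normrM powRM.
Qed.

(** The quotient is invariant under scaling, so it is enough to minimise the energy over the
    admissible functions of mass 1. These form a compact set of row vectors, nonempty because of an
    interior vertex. *)
Lemma lambda1p_attained (R : realType) (T : finType) (e : rel T) (p : R) :
  0 < p -> (exists x, x \notin boundary e) ->
  exists2 f, CB_nonzero e f & rayleigh e p f = lambda1p e p.
Proof.
move=> p0 [z zB].
pose F (v : 'rV[R]_#|T|) (x : T) := v ord0 (enum_rank x).
have cF x y : continuous (fun v => `|F v x - F v y| `^ p).
  move=> v; apply: (@continuous_comp _ _ _ (fun v => F v x - F v y)
    (fun t : R => `|t| `^ p)); last exact: norm_powR_continuous.
  by apply: (@continuousB _ R^o); exact: coord_continuous.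
have cF0 x : continuous (fun v => `|F v x| `^ p).
  move=> v; apply: (@continuous_comp _ _ _ (fun v => F v x)
    (fun t : R => `|t| `^ p)); last exact: norm_powR_continuous.
  exact: coord_continuous.
have cM : continuous (fun v => vertex_mass p (F v)).
  by apply: (continuous_big add_continuous) => x _; exact: cF0.
have cE : continuous (fun v => edge_energy e p (F v)).
  move=> v; apply: (@continuousM _ _ (fun v => \sum_x \sum_(y | e x y)
    `|F v x - F v y| `^ p) (fun=> 2^-1)); last exact: cst_continuous.
  move: v; apply: (continuous_big add_continuous) => x _.
  by apply: (continuous_big add_continuous) => y _; exact: cF.
(* A degenerate segment encodes the boundary condition, and [[-1, 1]] excludes no function of mass
   1. *)
pose A (i : 'I_#|T|) : set R :=
  if enum_val i \in boundary e then `[0, 0]%classic else `[-1, 1]%classic.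
pose K : set 'rV[R]_#|T| := ([set v : 'rV[R]_#|T| | forall i, A i (v ord0 i)] `&`
  [set v | vertex_mass p (F v) = 1])%classic.
have cK : compact K.
  apply: compact_closedI; last first.
    apply: (@preimage_closed _ _ (fun v => vertex_mass p (F v)) [set 1]%classic).
      by move=> v _; exact: cM.
    exact: closed_eq.
  by apply: rV_compact => i; rewrite /A; case: ifP => _; exact: segment_compact.
have massF (f : T -> R) x : `|f x| `^ p <= vertex_mass p f.
  rewrite /vertex_mass (bigD1 x)//= lerDl.
  by apply: sumr_ge0 => y _; exact: powR_ge0.
(* Dividing by the [p]-th root of the mass normalises [f] to mass 1. *)
pose N (f : T -> R) x := (vertex_mass p f) `^ (- p^-1) * f x.
have massN (f : T -> R) : (exists x, f x != 0) -> `|vertex_mass p f `^ (- p^-1)| `^ p =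
    (vertex_mass p f)^-1.
  move=> /(vertex_mass_gt0 p) f0.
  rewrite ger0_norm ?powR_ge0// -powRrM mulNr mulVf ?gt_eqF//.
  by rewrite powR_inv1 ?ltW.
have NK f : CB_nonzero e f -> K (\row_i N f (enum_val i)).
  move=> [fB f0].
  have FN : F (\row_i N f (enum_val i)) = N f.
    by apply/funext => x; rewrite /F mxE enum_rankK.
  have mN : vertex_mass p (N f) = 1.
    by rewrite vertex_massZ massN// mulVf// gt_eqF// vertex_mass_gt0.
  split=> /=; last by rewrite FN.
  move=> i; rewrite mxE /A; case: ifPn => iB /=; rewrite in_itv/=.
    by rewrite /N fB// mulr0 lexx.
  rewrite -ler_norml leNgt; apply/negP => N1.
  have := massF (N f) (enum_val i); rewrite mN leNgt => /negP; apply.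
  by have := gt0_ltr_powR p0 _ _ N1; rewrite powR1 !nnegrE; apply.
have K0 : (K !=set0)%classic.
  exists (\row_i N (fun x => (x == z)%:R) (enum_val i)); apply: NK; split.
    by move=> x xB; case: eqP => // xz; rewrite -xz xB in zB.
  by exists z; rewrite eqxx oner_neq0.
have [//|c] := compact_EVT_min K0 cK (f := fun v => edge_energy e p (F v)).
  by apply: continuous_subspaceT => v; exact: cE.
rewrite inE => -[/= cA c1] cmin.
have cCB : CB_nonzero e (F c).
  split.
    move=> x xB; have := cA (enum_rank x); rewrite /A enum_rankK xB /= in_itv/=.
    by rewrite -eq_le => /eqP.
  apply: contrapT => c0; have: vertex_mass p (F c) = 0.
    apply: big1 => x _; have [->|cx] := eqVneq (F c x) 0.
      by rewrite normr0 powR0 ?gt_eqF.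
    by exfalso; apply: c0; exists x.
  by rewrite c1 => /eqP; rewrite oner_eq0.
exists (F c) => //; apply/eqP; rewrite eq_le lambda1p_le_rayleigh// andbT.
apply: lb_le_inf; first by exists (rayleigh e p (F c)), (F c).
move=> _ [f fCB <-].
rewrite /rayleigh c1 divr1.
have := cmin _ (mem_set (NK _ fCB)).
have -> : F (\row_i N f (enum_val i)) = N f.
  by apply/funext => x; rewrite /F mxE enum_rankK.
by rewrite edge_energyZ massN; [rewrite mulrC|case: fCB].
Qed.

(** * Invariance under graph isomorphism *)

Lemma rayleigh_iso (R : realType) (T1 T2 : finType) (e1 : rel T1) (e2 : rel T2)
    (s : T1 -> T2) (p : R) (f : T2 -> R) :
  bijective s -> (forall x y, e2 (s x) (s y) = e1 x y) ->
  rayleigh e1 p (f \o s) = rayleigh e2 p f.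
Proof.
move=> bs es; have os := onW_bij predT bs.
rewrite /rayleigh /edge_energy /vertex_mass; congr (_ / _ / _); last first.
  by rewrite (reindex s).
rewrite (reindex s)//; apply: eq_bigr => x _; rewrite [RHS](reindex s)/=.
  by apply: eq_bigl => y; rewrite es.
exact: onW_bij bs.
Qed.

Lemma boundary_iso (T1 T2 : finType) (e1 : rel T1) (e2 : rel T2) (s : T1 -> T2) :
  bijective s -> (forall x y, e2 (s x) (s y) = e1 x y) ->
  forall x, (s x \in boundary e2) = (x \in boundary e1).
Proof.
move=> bs es x; rewrite !inE /deg; congr (_ == _).
rewrite -!sum1_card (reindex s)/=; first by apply: eq_bigl => y; rewrite !inE es.
exact: onW_bij bs.
Qed.

Lemma CB_nonzero_iso (R : realType) (T1 T2 : finType) (e1 : rel T1)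
    (e2 : rel T2) (s : T1 -> T2) (f : T2 -> R) :
  bijective s -> (forall x y, e2 (s x) (s y) = e1 x y) ->
  CB_nonzero e2 f <-> CB_nonzero e1 (f \o s).
Proof.
move=> bs es; have [t st ts] := bs.
split=> -[fB [x fx]]; split.
- by move=> y yB; apply: fB; rewrite (boundary_iso bs es).
- by exists (t x); rewrite /= ts.
- move=> y yB; have := fB (t y); rewrite /= ts; apply.
  by rewrite -(boundary_iso bs es) ts.
- by exists (s x).
Qed.

Lemma lambda1p_iso (R : realType) (T1 T2 : finType) (e1 : rel T1)
    (e2 : rel T2) (p : R) :
  graph_iso e1 e2 -> lambda1p e1 p = lambda1p e2 p.
Proof.
move=> [s [bs es]]; rewrite /lambda1p; congr inf; apply/seteqP.
have [t st ts] := bs; split=> _ [f fCB <-].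
  exists (f \o t); last by rewrite -(rayleigh_iso _ _ bs es)//=; congr rayleigh;
    apply/funext => x /=; rewrite st.
  apply/(CB_nonzero_iso _ bs es); congr (CB_nonzero e1 _) : fCB.
  by apply/funext => x /=; rewrite st.
by exists (f \o s); [exact/(CB_nonzero_iso _ bs es)|exact: rayleigh_iso].
Qed.

(** * Energies on numbered vertices and on the tadpole *)

Lemma edge_energy_ltn (R : realType) (n : nat) (e : rel 'I_n) (p : R)
    (f : 'I_n -> R) : symmetric e -> irreflexive e ->
  edge_energy e p f =
    \sum_(u : 'I_n * 'I_n | e u.1 u.2 && (u.1 < u.2)%N) `|f u.1 - f u.2| `^ p.
Proof.
move=> esym eirr; rewrite -(pair_big_dep xpredT (fun i j => e i j && (i < j)%N)
  (fun i j => `|f i - f j| `^ p)) /=.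
have split_lt : \sum_i \sum_(j | e i j) `|f i - f j| `^ p =
    \sum_i \sum_(j | e i j && (i < j)%N) `|f i - f j| `^ p +
    \sum_i \sum_(j | e i j && (j < i)%N) `|f i - f j| `^ p.
  rewrite -big_split; apply: eq_bigr => i _ /=.
  rewrite (bigID (fun j : 'I_n => (i < j)%N)) /=; congr (_ + _).
  apply: eq_bigl => j; case eij: (e i j) => //=.
  by case: (ltngtP i j) => // /val_inj ij; rewrite ij eirr in eij.
have swap : \sum_i \sum_(j | e i j && (j < i)%N) `|f i - f j| `^ p =
    \sum_i \sum_(j | e i j && (i < j)%N) `|f i - f j| `^ p.
  rewrite (exchange_big_dep xpredT)//=; apply: eq_bigr => i _.
  by apply: eq_big => j; rewrite 1?esym// distrC.
by rewrite /edge_energy split_lt swap; field.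
Qed.

Lemma tadpole_sym n i : symmetric (tadpole n i).
Proof.
move=> a b; rewrite /tadpole orbCA; do 2! congr (_ || _).
by rewrite orbC.
Qed.

Lemma tadpole3_irr n : irreflexive (tadpole n 3).
Proof. by move=> a; rewrite /tadpole; lia. Qed.

Lemma tadpole3_ltn n (a b : 'I_n) : (a < b)%N ->
  tadpole n 3 a b = (b == a.+1 :> nat) || (a == 0 :> nat) && (b == 2 :> nat).
Proof. by rewrite /tadpole => ab; lia. Qed.

(** This is the energy on the tadpole with [m.+1] vertices: the sum follows the path through all
    vertices, the last term is the edge closing the triangle. Taking [h] on [nat] keeps index shifts
    free of ordinals. *)
Definition tadpole_energy (R : realType) (m : nat) (p : R) (h : nat -> R) : R :=
  \sum_(0 <= k < m) `|h k - h k.+1| `^ p + `|h 0%N - h 2%N| `^ p.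

Lemma edge_energy_tadpole (R : realType) (m : nat) (p : R) (h : nat -> R) :
  (3 <= m)%N -> edge_energy (tadpole m.+1 3) p (h \o val) = tadpole_energy m p h.
Proof.
move=> m3; rewrite edge_energy_ltn; [|exact: tadpole_sym|exact: tadpole3_irr].
rewrite -(pair_big_dep xpredT (fun i j => tadpole m.+1 3 i j && (i < j)%N)
  (fun i j => `|(h \o val) i - (h \o val) j| `^ p)) /=.
pose G (i j : nat) : R := `|h i - h j| `^ p.
(* Each vertex but the last has its successor as a larger neighbour; only vertex 0 has a second one,
   the neck. *)
have inner (i : 'I_m.+1) : \sum_(j | tadpole m.+1 3 i j && (i < j)%N) G i j =
    (if (i.+1 < m.+1)%N then G i i.+1 else 0) + (if i == 0%N :> nat then G 0 2 else 0).
  rewrite (bigID (fun j : 'I_m.+1 => j == i.+1 :> nat)) /=; congr (_ + _).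
    transitivity (\sum_(j < m.+1 | j == i.+1 :> nat) G i j).
      by apply: eq_bigl => j; rewrite /tadpole; lia.
    by rewrite (@big_ord1_eq _ _ _ (G i)).
  case: (eqVneq (i : nat) 0) => i0; last first.
    by rewrite big_pred0// => j; rewrite /tadpole; lia.
  transitivity (\sum_(j < m.+1 | j == 2 :> nat) G i j).
    by apply: eq_bigl => j; rewrite /tadpole; lia.
  by rewrite (@big_ord1_eq _ _ _ (G i)) i0 ifT//; lia.
rewrite (eq_bigr _ (fun i _ => inner i)) big_split /=; congr (_ + _).
  rewrite big_ord_recr /= ltnn addr0 big_mkord; apply: eq_bigr => i _.
  by rewrite ltnS ltn_ord.
rewrite -big_mkcond /= (@big_ord1_eq _ _ _ (fun=> G 0 2)).
by [].
Qed.

Lemma sum_uniq_le (R : realType) (I : finType) (r : seq I) (P : pred I)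
    (F : I -> R) :
  uniq r -> all P r -> (forall i, P i -> 0 <= F i) ->
  \sum_(i <- r) F i <= \sum_(i | P i) F i.
Proof.
move=> ur /allP rP F0; rewrite big_uniq// big_mkcond [leRHS]big_mkcond.
apply: ler_sum => i _; case: ifP => [/rP ->//|_].
by case: ifP => // /F0.
Qed.

Lemma deg_gt1_other (T : finType) (e : rel T) (x z : T) :
  (1 < deg e x)%N -> exists2 y, e x y & y != z.
Proof.
case/card_gt1P => y [y'] [xy xy' yy']; rewrite !inE in xy xy'.
have [yz|] := eqVneq y z; last by exists y.
by exists y' => //; rewrite -yz eq_sym.
Qed.

(** * Edge weights for a nonincreasing function *)

Section SortedFunction.

Variables (R : realType) (p : R) (m : nat) (h : nat -> R).
Hypotheses (p1 : 1 < p) (m3 : (3 <= m)%N).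
Hypothesis h_dec : forall i j, (i <= j <= m)%N -> h j <= h i.

(* Vertices are numbered by nonincreasing value, so 0 and 1 form the free end
   of the head and 2 is the neck. The part of an edge [i < j] above the level
   [h 2] is kept whole, the part below is cut into elementary steps. *)
Definition edge_weight (i j : nat) : R :=
  (h (minn i 2) - h (minn j 2)) `^ p +
  \sum_(2 <= k < m | (i <= k < j)%N) (h k - h k.+1) `^ p.

Let pN0 : p != 0. Proof. by rewrite gt_eqF// (lt_trans _ p1). Qed.

Lemma step_ge0 k : (k < m)%N -> 0 <= h k - h k.+1.
Proof. by move=> km; rewrite subr_ge0 h_dec//; lia. Qed.

(** The filtered sum of the definition suits counting edges across a cut; the contiguous range
    obtained here suits telescoping. *)
Lemma edge_weightE i j : (j <= m)%N -> edge_weight i j =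
  (h (minn i 2) - h (minn j 2)) `^ p +
  \sum_(maxn i 2 <= k < j) (h k - h k.+1) `^ p.
Proof.
move=> jm; congr (_ + _); rewrite (big_nat_widen _ j m)//=.
rewrite (big_nat_widenl (maxn i 2) 2) /=; last by lia.
by apply: congr_big_nat => // k k2; lia.
Qed.

Lemma sum_steps i j : (i <= j)%N ->
  \sum_(i <= k < j) (h k - h k.+1) = h i - h j.
Proof.
move=> ij; rewrite -opprB -telescope_sumr// -sumrN.
by apply: eq_bigr => k _; rewrite opprB.
Qed.

Lemma sum_steps_powR_le i j : (i <= j <= m)%N ->
  \sum_(i <= k < j) (h k - h k.+1) `^ p <= (h i - h j) `^ p.
Proof.
move=> ij; rewrite -sum_steps; last by lia.
rewrite !big_nat; apply: powR_sum_superadditive => // k kij.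
by apply: step_ge0; lia.
Qed.

(** An edge stays below the level [h 2], stays above it, or passes through it. Superadditivity
    splits the drop at that level in the last case, and into steps below it. *)
Lemma edge_weight_le i j : (i < j <= m)%N -> edge_weight i j <= `|h i - h j| `^ p.
Proof.
move=> ij; rewrite edge_weightE; last by lia.
rewrite ger0_norm ?subr_ge0 ?h_dec//; last by lia.
have [i2|i2] := leqP 2 i.
  rewrite (minn_idPr _) ?subrr ?powR0 ?add0r//; last by lia.
  by rewrite sum_steps_powR_le//; lia.
have [j2|j2] := leqP j 2.
  by rewrite big_geq ?addr0//; lia.
have -> : h i - h j = (h i - h 2%N) + (h 2%N - h j) by ring.
apply: le_trans (powR_superadditive p1 _ _); rewrite ?subr_ge0 ?h_dec; try lia.
by rewrite lerD2l sum_steps_powR_le//; lia.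
Qed.

(** An edge outside the tadpole either starts at index 2 or later and skips a vertex, or joins 0 or
    1 to a vertex past the neck. Its drop is then cut into two positive parts, where superadditivity
    is strict. *)
Lemma edge_weight_lt i j : (forall k, (0 < k < m)%N -> h k.+1 < h k) ->
  (i < j <= m)%N -> j != i.+1 -> ~~ ((i == 0%N) && (j == 2)%N) ->
  edge_weight i j < `|h i - h j| `^ p.
Proof.
move=> h_sdec ij jSi ij02.
have h_lt a b : (0 < a < b)%N && (b <= m)%N -> h b < h a.
  move=> ab; apply: le_lt_trans (h_sdec a _); last by lia.
  by apply: h_dec; lia.
rewrite edge_weightE; last by lia.
rewrite ger0_norm ?subr_ge0 ?h_dec//; last by lia.
have [i2|i2] := leqP 2 i.
  rewrite (minn_idPr _) ?subrr ?powR0 ?add0r//; last by lia.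
  rewrite big_ltn; last by lia.
  have -> : h i - h j = (h i - h i.+1) + (h i.+1 - h j) by ring.
  apply: le_lt_trans (powR_strictly_superadditive p1 _ _);
    rewrite ?subr_gt0 ?h_lt; try lia.
  by rewrite lerD2l sum_steps_powR_le//; lia.
rewrite (minn_idPr _); last by lia.
have -> : h i - h j = (h i - h 2%N) + (h 2%N - h j) by ring.
apply: le_lt_trans (powR_strictly_superadditive p1 _ _).
- by rewrite lerD2l sum_steps_powR_le//; lia.
- rewrite subr_gt0; apply: (lt_le_trans (h_lt 1%N 2%N _)); first by lia.
  by apply: h_dec; lia.
- by rewrite subr_gt0 h_lt//; lia.
Qed.

Variable e : rel 'I_m.+1.
Hypotheses (esym : symmetric e) (eirr : irreflexive e).
Hypothesis ecut : forall k, (k < m)%N ->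
  exists i j : 'I_m.+1, e i j /\ (i <= k < j)%N.

Let fwd (u : 'I_m.+1 * 'I_m.+1) := e u.1 u.2 && (u.1 < u.2)%N.

Lemma edge_weight_sum_le :
  \sum_(u | fwd u) edge_weight u.1 u.2 <= edge_energy e p (h \o val).
Proof.
rewrite edge_energy_ltn//; apply: ler_sum => -[i j] /andP[/= _ ij].
by apply: edge_weight_le; have := ltn_ord j; lia.
Qed.

Lemma edge_weight_sum_lt (i j : 'I_m.+1) :
  (forall k, (0 < k < m)%N -> h k.+1 < h k) ->
  e i j -> ~~ tadpole m.+1 3 i j ->
  \sum_(u | fwd u) edge_weight u.1 u.2 < edge_energy e p (h \o val).
Proof.
move=> h_sdec; wlog ij : i j / (i < j)%N.
  move=> H eij tij; have [ij|ji|/val_inj ij] := ltngtP i j.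
  - exact: (H i j).
  - by apply: (H j i) => //; rewrite 1?esym// tadpole_sym.
  - by rewrite ij eirr in eij.
move=> eij tij; rewrite edge_energy_ltn// (bigD1 (i, j)) ?/fwd /= ?eij//.
rewrite [ltRHS](bigD1 (i, j)) /= ?eij// ltr_leD//.
  by apply: edge_weight_lt => //; have := ltn_ord j;
    move: tij; rewrite tadpole3_ltn//; lia.
apply: ler_sum => -[i' j'] /andP[/andP[/= _ ij'] _].
by apply: edge_weight_le; have := ltn_ord j'; lia.
Qed.

(** After exchanging the sums, step [k] is counted once for each edge crossing the cut between [k]
    and [k.+1], and [ecut] provides such an edge. *)
Lemma low_steps_le_cuts : \sum_(2 <= k < m) (h k - h k.+1) `^ p <=
  \sum_(u | fwd u) \sum_(2 <= k < m | (u.1 <= k < u.2)%N) (h k - h k.+1) `^ p.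
Proof.
rewrite (exchange_big_dep xpredT)//= big_nat [leRHS]big_nat.
apply: ler_sum => k k2m; have [|i [j [eij ikj]]] := @ecut k; first by lia.
rewrite (bigD1 (i, j)) /=; last by rewrite /fwd /= eij; lia.
by rewrite lerDl sumr_ge0// => u _; rewrite powR_ge0.
Qed.

(** The cuts pay for the steps below the neck. In the top part all vertices from the neck on sit at
    level [h 2], and edges at 0 and 1 pay for the triangle. When [h 1 = h 2], vertex 1 may be a
    boundary vertex, but its side to the neck costs nothing. *)
Lemma tadpole_energy_le_edge_weights :
  (1 < deg e ord0)%N -> h 1%N = h 2%N \/ (1 < deg e (inord 1))%N ->
  tadpole_energy m p h <= \sum_(u | fwd u) edge_weight u.1 u.2.
Proof.
move=> deg0 deg1.
rewrite /edge_weight big_split /= /tadpole_energy.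
have -> : \sum_(0 <= k < m) `|h k - h k.+1| `^ p = (h 0%N - h 1%N) `^ p +
    ((h 1%N - h 2%N) `^ p + \sum_(2 <= k < m) (h k - h k.+1) `^ p).
  rewrite 2?big_ltn; try lia; rewrite !ger0_norm ?step_ge0; try lia.
  congr (_ + (_ + _)); apply: eq_big_nat => k k2.
  by rewrite ger0_norm// step_ge0//; lia.
rewrite ger0_norm ?subr_ge0 ?h_dec; try lia.
suff top_le : (h 0%N - h 1%N) `^ p + (h 1%N - h 2%N) `^ p +
    (h 0%N - h 2%N) `^ p <=
    \sum_(u | fwd u) (h (minn u.1 2) - h (minn u.2 2)) `^ p.
  by have := low_steps_le_cuts; lra.
pose F (u : 'I_m.+1 * 'I_m.+1) := (h (minn u.1 2) - h (minn u.2 2)) `^ p.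
have F0 u : fwd u -> 0 <= F u by move=> _; exact: powR_ge0.
pose o0 : 'I_m.+1 := ord0; pose o1 : 'I_m.+1 := inord 1.
have o1E : o1 = 1%N :> nat by rewrite inordK//; lia.
have ge2 (i j : 'I_m.+1) : (i <= 1)%N -> e i j -> j != o0 -> j != o1 -> (2 <= j)%N.
  by move=> i1 eij; rewrite -!val_eqE /= o1E; lia.
have eN0 (j : 'I_m.+1) : e o0 j -> j != o0.
  by move=> e0j; apply/eqP => j0; rewrite j0 eirr in e0j.
(* If 0 and 1 are adjacent, their edge and one further edge from each stand for the three sides;
   when [h 1 = h 2] the further edge from 1 is dispensed with. *)
have [e01|Ne01] := boolP (e o0 o1).
  have [j e0j j1] := deg_gt1_other o1 deg0.
  have j2 : (2 <= j)%N by apply: (ge2 o0 j) => //; exact: eN0.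
  case: deg1 => [h12|deg1].
    have := @sum_uniq_le _ _ [:: (o0, o1); (o0, j)] fwd F _ _ F0.
    rewrite /= !big_cons big_nil /F /= o1E (minn_idPr j2) h12 subrr powR0// !addr0.
    apply; first by rewrite !inE xpair_eqE eqxx eq_sym j1.
    by rewrite /fwd /= e01 e0j o1E /= andbT; lia.
  have [j' e1j' j'0] := deg_gt1_other o0 deg1.
  have j'2 : (2 <= j')%N.
    apply: (ge2 o1 j') => //; first by rewrite o1E.
    by apply/eqP => j'1; rewrite j'1 eirr in e1j'.
  have := @sum_uniq_le _ _ [:: (o0, o1); (o0, j); (o1, j')] fwd F _ _ F0.
  rewrite /= !big_cons big_nil /F /= o1E (minn_idPr j2) (minn_idPr j'2) addr0.
  rewrite -addrA [X in _ + X]addrC; apply.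
    by rewrite !inE !xpair_eqE -!val_eqE /= o1E; lia.
  by rewrite /fwd /= e01 e0j e1j' o1E /= andbT; lia.
(* Otherwise two edges from 0 reach the neck or beyond and pay twice for the side from 0 to 2. By
   superadditivity one copy covers the two other sides. *)
have /card_gt1P[j [j' [e0j e0j' jj']]] := deg0; rewrite !inE in e0j e0j'.
have N1 (i : 'I_m.+1) : e o0 i -> i != o1.
  by move=> e0i; apply: contraNneq Ne01 => <-.
have j2 : (2 <= j)%N by apply: (ge2 o0 j) => //; [exact: eN0|exact: N1].
have j'2 : (2 <= j')%N by apply: (ge2 o0 j') => //; [exact: eN0|exact: N1].
have := @sum_uniq_le _ _ [:: (o0, j); (o0, j')] fwd F _ _ F0.
rewrite /= !big_cons big_nil /F /= (minn_idPr j2) (minn_idPr j'2) addr0.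
move=> H; apply: le_trans (H _ _).
- rewrite min0n lerD2r.
  have -> : h 0%N - h 2%N = (h 0%N - h 1%N) + (h 1%N - h 2%N) by ring.
  by apply: powR_superadditive; rewrite ?subr_ge0 ?h_dec//; lia.
- by rewrite !inE xpair_eqE negb_and jj' orbT.
- by rewrite /fwd /= e0j e0j' /= andbT; lia.
Qed.

End SortedFunction.

(** * Minimisers on the tadpole *)

Lemma tadpole_energy_gt0 (R : realType) (p : R) (m : nat) (h : nat -> R) :
  h m = 0 -> 0 < h 0%N -> 0 < tadpole_energy m p h.
Proof.
move=> hm h0; rewrite /tadpole_energy ltr_pwDl ?powR_ge0//.
rewrite lt_def sumr_ge0 ?andbT; last by move=> k _; exact: powR_ge0.
apply: contraTneq h0 => /eqP; rewrite psumr_eq0; last by move=> k _; exact: powR_ge0.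
move=> /allP d0; rewrite -leNgt.
have -> : h 0%N = - (h m - h 0%N) by rewrite hm sub0r opprK.
rewrite -telescope_sumr//.
rewrite big_nat big1 ?oppr0// => k km; apply/eqP.
have := d0 k; rewrite mem_index_iota => /(_ km) /=.
by rewrite powR_eq0 normr_eq0 subr_eq0 => /andP[/eqP -> _]; rewrite subrr.
Qed.

Lemma tadpole_minimizer_decreasing (R : realType) (p : R) (m : nat)
    (h : nat -> R) :
  1 < p -> (3 <= m)%N -> (forall i j, (i <= j <= m)%N -> h j <= h i) ->
  h m = 0 -> 0 < h 0%N ->
  (forall g : nat -> R, g m = 0 -> 0 < g 0%N ->
    tadpole_energy m p h * vertex_mass p (g \o val : 'I_m.+1 -> R) <=
    tadpole_energy m p g * vertex_mass p (h \o val : 'I_m.+1 -> R)) ->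
  forall k, (0 < k < m)%N -> h k.+1 < h k.
Proof.
move=> p1 m3 h_dec hm h0 h_min k km.
(* If [h k.+1 = h k], raising [h 0 .. h k] by [t] costs at most [2 t^p] of
   energy but gains a mass of order [t], which beats [h] for small [t]. The
   exception is [k = 1], [h 1 < h 0], where the energy also moves at first
   order: there, raising [h 1] to [h 0] keeps the energy and gains mass. *)
have p0 : 0 < p by rewrite (lt_trans _ p1).
have pN0 : p != 0 by rewrite gt_eqF.
have h_ge0 i : (i <= m)%N -> 0 <= h i by move=> im; rewrite -hm h_dec// im leqnn.
have E0 := tadpole_energy_gt0 p hm h0.
have M0 : 0 < vertex_mass p (h \o val : 'I_m.+1 -> R).
  by apply: vertex_mass_gt0; exists ord0; rewrite /= gt_eqF.
rewrite lt_neqAle h_dec ?andbT; last by lia.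
apply/eqP => hk.
have [[k1 h01]|h_flat] : (k = 1%N /\ h 1%N < h 0%N) \/ (k = 1%N -> h 0%N = h 1%N).
  case: (eqVneq k 1%N) => [->|/eqP kN1]; last by right => /kN1.
  have : h 1%N <= h 0%N by apply: h_dec; lia.
  by rewrite le_eqVlt => /predU1P[h10|]; [right|left].
  have h12 : h 2%N = h 1%N by rewrite -k1.
  pose g i := if i == 1%N then h 0%N else h i.
  have gE : tadpole_energy m p g = tadpole_energy m p h.
    rewrite /tadpole_energy; congr (_ + _).
    rewrite 2?big_ltn; try lia; rewrite [RHS]big_ltn; last by lia.
    rewrite [in RHS]big_ltn; last by lia.
    rewrite /g /= h12 !subrr normr0 powR0// add0r [in RHS]addrA addr0.
    by congr (_ + _); apply: eq_big_nat => i i2; rewrite !ifN//; lia.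
  have gm : g m = 0 by rewrite /g ifN//; lia.
  have := h_min g gm h0; rewrite gE ler_pM2l// leNgt => /negP; apply.
  have o1 : (1 < m.+1)%N by lia.
  rewrite /vertex_mass (bigD1 (Ordinal o1))//= [ltRHS](bigD1 (Ordinal o1))//=.
  have h1_ge0 : 0 <= h 1%N by apply: h_ge0; lia.
  rewrite ltr_leD//.
    rewrite /g /= !ger0_norm ?(ltW h0)//.
    by apply: gt0_ltr_powR; rewrite ?nnegrE ?(ltW h0).
  by apply: ler_sum => i i1; rewrite /g ifN.
pose g t i := if (i <= k)%N then h i + t else h i.
(* The step after [k] grows from 0 to [t]. For [k = 1] so does the edge between 0 and 2, since [h]
   is constant there; hence the factor 2. *)
have gE t : 0 <= t -> tadpole_energy m p (g t) <= tadpole_energy m p h + 2 * t `^ p.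
  move=> t0; rewrite /tadpole_energy mulrDl mul1r addrACA; apply: lerD.
    rewrite (@big_cat_nat _ _ _ k) /=; try lia.
    rewrite [in leRHS](@big_cat_nat _ _ _ k) /=; try lia.
    rewrite -addrA lerD//.
      rewrite le_eqVlt (eq_big_nat _ _ (F2 := fun i => `|h i - h i.+1| `^ p)) ?eqxx// => i ik.
      by rewrite /g !ifT; try lia; congr (`|_| `^ p); ring.
    rewrite big_ltn; last by lia. rewrite [in leRHS]big_ltn; last by lia.
    rewrite addrAC lerD//.
      rewrite /g leqnn ltnn hk addrAC subrr add0r ger0_norm//.
      by rewrite normr0 powR0// add0r.
    rewrite le_eqVlt (eq_big_nat _ _ (F2 := fun i => `|h i - h i.+1| `^ p)) ?eqxx// => i ik.
    by rewrite /g !ifN//; lia.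
  have [k1|k1] := eqVneq k 1%N.
    have h21 : h 2%N = h 1%N by move: hk; rewrite k1.
    rewrite /g k1 /= (h_flat k1) h21 addrAC subrr add0r ger0_norm//.
    by rewrite normr0 powR0// add0r.
  rewrite /g /= ifT; last by lia.
  have -> : h 0%N + t - (h 2%N + t) = h 0%N - h 2%N by ring.
  by rewrite lerDl powR_ge0.
(* The gain is measured at vertex 0 alone; elsewhere the mass does not drop because [h] is
   nonnegative. *)
have gM t : 0 <= t -> vertex_mass p (h \o val : 'I_m.+1 -> R) + t * h 0%N `^ (p - 1)
    <= vertex_mass p (g t \o val : 'I_m.+1 -> R).
  move=> t0; rewrite /vertex_mass (bigD1 ord0)//= [leRHS](bigD1 ord0)//=.
  rewrite addrAC lerD//.
    rewrite /g /= !ger0_norm ?addr_ge0 ?(ltW h0)//.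
    by rewrite powR_bernoulli// ltW.
  apply: ler_sum => i _; have hi : 0 <= h i by rewrite h_ge0// -ltnS.
  rewrite /g; case: ifP => // _; rewrite !ger0_norm ?addr_ge0//.
  by apply: ge0_ler_powR; rewrite ?nnegrE ?addr_ge0 ?lerDl ?(ltW p0).
set E := tadpole_energy m p h in E0 gE h_min.
set M := vertex_mass p (h \o val) in M0 gM h_min.
pose q := h 0%N `^ (p - 1).
have q0 : 0 < q by rewrite powR_gt0.
have pB1 : 0 < p - 1 by rewrite subr_gt0.
(* With [t] chosen so that its [p]-th power is [t * c], the extra energy contributes at most
   [t * E * q / 2], half of what the gain in mass contributes on the other side. *)
pose c := E * q / (4 * M).
have c0 : 0 < c by rewrite divr_gt0 ?mulr_gt0.
pose t := c `^ (p - 1)^-1.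
have t0 : 0 < t by rewrite powR_gt0.
have tp : t `^ p = t * c.
  rewrite (powRB1_split p1 (ltW t0)) /t -powRrM mulVf ?powRr1 ?(ltW c0)//.
  by rewrite gt_eqF.
have gm : g t m = 0 by case/andP: km => _ km; rewrite /g leqNgt km.
have := h_min (g t) gm (addr_gt0 h0 t0).
apply/negP; rewrite -ltNge.
apply: (@le_lt_trans _ _ ((E + 2 * t `^ p) * M)).
  by rewrite ler_wpM2r ?(ltW M0)// gE// ltW.
apply: (@lt_le_trans _ _ (E * (M + t * q))); last first.
  by rewrite ler_wpM2l ?(ltW E0)// gM// ltW.
have cE : c * (4 * M) = E * q by rewrite /c mulfVK// gt_eqF// mulr_gt0.
have tEq : 0 < t * (E * q) by rewrite !mulr_gt0.
rewrite tp; have -> : (E + 2 * (t * c)) * M = E * M + t * (c * (4 * M)) / 2 by field.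
by rewrite cE; lra.
Qed.

(** * Connectedness and interior vertices *)

(** With [P] an initial segment of the numbering this yields the crossed cuts, with [P] a singleton
    it yields a neighbour. *)
Lemma connect_crossing (T : finType) (e : rel T) (P : pred T) (x y : T) :
  connect e x y -> P x -> ~~ P y -> exists u v, [/\ e u v, P u & ~~ P v].
Proof.
case/connectP => r; elim: r x => [|z r IHr] x /=; first by move=> _ -> ->.
case/andP => exz ezr yE Px NPy; have [Pz|NPz] := boolP (P z).
  exact: IHr ezr yE Pz NPy.
by exists x, z.
Qed.

(** If all degrees were 1, an edge would be a whole component, against connectedness on three
    vertices. *)
Lemma exists_interior (T : finType) (e : rel T) :
  symmetric e -> (forall x y, connect e x y) -> (3 <= #|T|)%N ->
  exists x, x \notin boundary e.
Proof.
move=> esym econn /card_gt2P[x [y [z [_ [xy yz zx]]]]].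
apply: contrapT => noint.
have nbr1 u v w : e u v -> e u w -> v = w.
  move=> uv uw; apply/eqP/negPn/negP => vw; apply: noint; exists u.
  rewrite inE neq_ltn orbC; apply/orP; left; apply/card_gt1P.
  by exists v, w.
have [||u [a [xa /eqP uE _]]] := @connect_crossing _ e (pred1 x) _ _ (econn x y).
- by rewrite /= eqxx.
- by rewrite /= eq_sym.
rewrite uE in xa; have [w wxa] : exists w, w \notin pred2 x a.
  have [ya|ya] := eqVneq y a; last by exists y; rewrite !inE negb_or eq_sym xy.
  by exists z; rewrite !inE negb_or zx -ya eq_sym.
have [||t [v [tv]]] := @connect_crossing _ e (pred2 x a) _ _ (econn x w).
- by rewrite /= eqxx.
- by [].
move=> /pred2P[] tE; rewrite tE in tv => /negP; apply; apply/pred2P.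
  by right; apply: nbr1 tv xa.
by left; apply: (nbr1 a) => //; rewrite esym.
Qed.

(** Vertex 0 has the neighbours 1 and 2, and any other vertex before [m] has both path neighbours.
    Hence a function vanishing at [m] meets the boundary condition. *)
Lemma tadpole3_boundary (m : nat) (x : 'I_m.+1) : (3 <= m)%N ->
  x \in boundary (tadpole m.+1 3) -> x = m :> nat.
Proof.
move=> m3; rewrite inE => /eqP dx; apply/eqP; apply: contraTT isT => xm.
have xltm : (x < m)%N by have := ltn_ord x; lia.
suff: (1 < deg (tadpole m.+1 3) x)%N by rewrite dx.
have inordE k : (k <= m)%N -> (inord k : 'I_m.+1) = k :> nat.
  by move=> km; rewrite inordK.
apply/card_gt1P; have [x0|x0] := posnP x.
  exists (inord 1), (inord 2).
  by split; rewrite ?inE /tadpole -?val_eqE /= !inordE ?x0//; lia.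
exists (inord x.-1), (inord x.+1).
by split; rewrite ?inE /tadpole -?val_eqE /= !inordE//; lia.
Qed.

(** * Rearrangement and comparison with the tadpole *)

Lemma nonincreasing_enumeration (R : realType) (T : finType) (f : T -> R) :
  exists2 s : 'I_#|T| -> T, bijective s &
    forall i j : 'I_#|T|, (i <= j)%N -> f (s j) <= f (s i).
Proof.
pose ge_f x y := f y <= f x.
have sz : size (sort ge_f (enum T)) == #|T| by rewrite size_sort -cardE.
pose t := Tuple sz.
exists (tnth t).
  apply: inj_card_bij; last by rewrite card_ord.
  by apply/tuple_uniqP; rewrite /= sort_uniq enum_uniq.
move=> i j ij; have x0 := tnth t i; rewrite !(tnth_nth x0).
apply: (sorted_leq_nth (leT := ge_f)) => //.
- by move=> y x z yx zy; exact: le_trans zy yx.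
- by move=> x; exact: lexx.
- by apply: sort_sorted => x y; rewrite /ge_f le_total.
- by rewrite inE (eqP sz).
- by rewrite inE (eqP sz).
Qed.

(** For the second part, one edge outside the tadpole would make the energy of [e] strictly larger.
    So [e] is a subgraph, and the degrees of 0 and 1 together with the cuts from the neck on supply
    every edge. *)
Lemma tadpole_energy_comparison (R : realType) (p : R) (m : nat)
    (e : rel 'I_m.+1) (h : nat -> R) :
  1 < p -> (3 <= m)%N -> symmetric e -> irreflexive e ->
  (forall x y, connect e x y) ->
  (forall i j, (i <= j <= m)%N -> h j <= h i) -> h m = 0 -> 0 < h 0%N ->
  (forall x : 'I_m.+1, x \in boundary e -> h x = 0) ->
  tadpole_energy m p h <= edge_energy e p (h \o val) /\
  ((forall k, (0 < k < m)%N -> h k.+1 < h k) ->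
    edge_energy e p (h \o val) <= tadpole_energy m p h ->
    e =2 tadpole m.+1 3).
Proof.
move=> p1 m3 esym eirr econn h_dec hm h0 hB.
have ecut k : (k < m)%N -> exists i j : 'I_m.+1, e i j /\ (i <= k < j)%N.
  move=> km.
  have [||i [j [eij ik kj]]] :=
    @connect_crossing _ e (fun i => i <= k)%N _ _ (econn ord0 ord_max).
  - by [].
  - by rewrite /= -ltnNge.
  - by exists i, j; rewrite ik ltnNge kj.
(* A vertex with positive value is interior, which excludes degree 1; connectedness excludes degree
   0. *)
have deg_gt1 (x : 'I_m.+1) : 0 < h x -> (1 < deg e x)%N.
  move=> hx; have [y xy] : exists y, e x y.
    have [z zx] : exists z : 'I_m.+1, z != x.
      have [->|x0] := eqVneq x ord0; last by exists ord0; rewrite eq_sym.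
      by exists ord_max; rewrite -val_eqE /=; lia.
    have [||u [v [uv /eqP <- _]]] := @connect_crossing _ e (pred1 x) _ _ (econn x z).
    - by rewrite /= eqxx.
    - by [].
    - by exists v.
  have : deg e x != 1%N.
    by apply/negP => d1; have := hB x d1; apply/eqP; rewrite gt_eqF.
  have : (0 < deg e x)%N by apply/card_gt0P; exists y; rewrite inE.
  by lia.
have o1E : (inord 1 : 'I_m.+1) = 1%N :> nat by rewrite inordK//; lia.
have h_ge0 i : (i <= m)%N -> 0 <= h i by move=> im; rewrite -hm h_dec// im leqnn.
have deg0 : (1 < deg e ord0)%N by exact: deg_gt1.
(* If [h 1] vanishes then so does [h 2]; otherwise vertex 1 is interior. *)
have deg1 : h 1%N = h 2%N \/ (1 < deg e (inord 1))%N.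
  have : 0 <= h 1%N by apply: h_ge0; lia.
  rewrite le_eqVlt => /predU1P[h10|h10]; [left|right].
    apply/eqP; rewrite eq_le -{1}h10 h_ge0 ?h_dec//; lia.
  by apply: deg_gt1; rewrite o1E.
have weights_ge := tadpole_energy_le_edge_weights p1 m3 h_dec eirr ecut deg0 deg1.
split; first exact: le_trans weights_ge (edge_weight_sum_le p1 m3 h_dec esym eirr).
move=> h_sdec energy_le.
have sub i j : e i j -> tadpole m.+1 3 i j.
  move=> eij; apply: contraTT energy_le => tij; rewrite -ltNge.
  apply: le_lt_trans weights_ge _.
  exact: edge_weight_sum_lt eij tij.
(* With degree at least 2 and only two candidates, both candidates are neighbours. *)
have e_neighbours (i j k : 'I_m.+1) : (1 < deg e i)%N ->
    (forall l, tadpole m.+1 3 i l -> l = j \/ l = k) -> e i j /\ e i k.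
  move=> di ijk.
  have [y iy yj] := deg_gt1_other j di; have [z iz zk] := deg_gt1_other k di.
  split.
    by case: (ijk z (sub _ _ iz)) => [<-//|/eqP]; rewrite (negPf zk).
  by case: (ijk y (sub _ _ iy)) => [/eqP|<-//]; rewrite (negPf yj).
have o2E : (inord 2 : 'I_m.+1) = 2%N :> nat by rewrite inordK//; lia.
have [e01 e02] : e ord0 (inord 1) /\ e ord0 (inord 2).
  apply: e_neighbours => // l tl.
  have [l1|l2] : l = 1%N :> nat \/ l = 2%N :> nat.
  - by move: tl; rewrite /tadpole /=; lia.
  - by left; apply/val_inj; rewrite /= o1E.
  - by right; apply/val_inj; rewrite /= o2E.
have [_ e12] : e (inord 1) ord0 /\ e (inord 1) (inord 2).
  apply: e_neighbours.
    apply: deg_gt1; rewrite o1E; apply: le_lt_trans (h_sdec 1%N _); last by lia.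
    by apply: h_ge0; lia.
  move=> l tl; have [l1|l2] : l = 0%N :> nat \/ l = 2%N :> nat.
  - by move: tl; rewrite /tadpole /= o1E; lia.
  - by left; apply/val_inj.
  - by right; apply/val_inj; rewrite /= o2E.
suff tsub (i j : 'I_m.+1) : (i < j)%N -> tadpole m.+1 3 i j -> e i j.
  move=> i j; apply/idP/idP; first exact: sub.
  move=> tij; have [ij|ji|/val_inj ij] := ltngtP i j; first exact: tsub.
    by rewrite esym; apply: tsub => //; rewrite tadpole_sym.
  by rewrite ij tadpole3_irr in tij.
move=> ij; rewrite tadpole3_ltn// => /orP[/eqP jE|/andP[/eqP i0 /eqP j2]]; last first.
  have -> : i = ord0 by exact/val_inj.
  by have -> : j = inord 2 by apply/val_inj; rewrite /= o2E.
(* From the neck on, the only tadpole edge across the cut after [i] goes from [i] to [i.+1], so the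
   crossing edge of [e] is this one. *)
have [i2|] := leqP 2 i.
  have [|a [b [eab iab]]] := ecut i; first by have := ltn_ord j; lia.
  have tab := sub _ _ eab; rewrite tadpole3_ltn in tab; last by lia.
  have -> : i = a by apply/val_inj => /=; lia.
  by have -> : j = b by apply/val_inj => /=; lia.
case: (eqVneq (i : nat) 0%N) => i0 i2.
  have -> : i = ord0 by exact/val_inj.
  by have -> : j = inord 1 by apply/val_inj; rewrite /= o1E; lia.
have -> : i = inord 1 by apply/val_inj; rewrite /= o1E; lia.
by have -> : j = inord 2 by apply/val_inj; rewrite /= o2E; lia.
Qed.

Lemma edge_energy_norm_le (R : realType) (T : finType) (e : rel T) (p : R)
    (f : T -> R) : 0 < p ->
  edge_energy e p (fun x => `|f x|) <= edge_energy e p f.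
Proof.
move=> p0; rewrite /edge_energy ler_wpM2r ?invr_ge0//.
apply: ler_sum => x _; apply: ler_sum => y _.
by apply: ge0_ler_powR; rewrite ?nnegrE ?(ltW p0)// ler_dist_dist.
Qed.

Lemma graph_iso_of_enumeration (T : finType) (e : rel T) (n : nat)
    (e2 : rel 'I_n) (s : 'I_n -> T) :
  bijective s -> (forall i j, e (s i) (s j) = e2 i j) -> graph_iso e e2.
Proof.
case=> t st ts es; exists t; split; first by exists s.
by move=> x y; rewrite -es !ts.
Qed.

(** Replacing [f] by its absolute value keeps the mass and does not raise the energy; numbering by
    [s] then reduces to the sorted case. If the quotient of [f] is at most the tadpole eigenvalue,
    the chain of inequalities closes up and [h] minimises on the tadpole. *)
Lemma tadpole_rayleigh_comparison (R : realType) (p : R) (T : finType)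
    (e : rel T) (n : nat) (s : 'I_n -> T) (f : T -> R) :
  1 < p -> symmetric e -> irreflexive e -> (forall x y, connect e x y) ->
  (4 <= n)%N -> (exists x, x \in boundary e) ->
  bijective s -> (forall i j : 'I_n, (i <= j)%N -> `|f (s j)| <= `|f (s i)|) ->
  CB_nonzero e f ->
  lambda1p (tadpole n 3) p <= rayleigh e p f /\
  (rayleigh e p f <= lambda1p (tadpole n 3) p -> graph_iso e (tadpole n 3)).
Proof.
case: n s => [//|m] s p1 esym eirr econn m3 [b bB] bs s_dec [fB [x0 fx0]].
have p0 : 0 < p by rewrite (lt_trans _ p1).
have [t st ts] := bs.
pose e' : rel 'I_m.+1 := fun i j => e (s i) (s j).
(* Values beyond index [m] are junk; monotonicity is claimed only up to [m]. *)
pose h k := `|f (s (inord k))|.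
have hE : h \o val = (fun x => `|f x|) \o s :> ('I_m.+1 -> R).
  by apply/funext => i; rewrite /h /= inord_val.
have h_dec i j : (i <= j <= m)%N -> h j <= h i.
  by move=> ij; apply: s_dec; rewrite !inordK//; lia.
have h_val (i : 'I_m.+1) : h i = `|f (s i)| by rewrite /h inord_val.
(* The boundary vertex [b] has value 0, and the last value is no larger. *)
have hm : h m = 0.
  apply/eqP; rewrite eq_le normr_ge0 andbT.
  have := h_dec (t b) m; rewrite h_val ts fB// normr0; apply.
  by rewrite leqnn andbT -ltnS ltn_ord.
have h0 : 0 < h 0%N.
  apply: (@lt_le_trans _ _ (h (t x0))); first by rewrite h_val ts normr_gt0.
  by apply: h_dec; rewrite leq0n -ltnS ltn_ord.
have e'conn i j : connect e' i j.
  have [r] := connectP (econn (s i) (s j)).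
  elim: r i => [|x r IHr] i /=; first by move=> _ /(can_inj st) ->.
  case/andP => eix exr jE; apply: (connect_trans (y := t x)).
    by apply: connect1; rewrite /e' ts.
  by apply: IHr; rewrite ts.
have hB (i : 'I_m.+1) : i \in boundary e' -> h i = 0.
  by rewrite -(boundary_iso (e2 := e) bs)// => /fB; rewrite h_val => ->; rewrite normr0.
have [E_le E_eq] := tadpole_energy_comparison (e := e') p1 m3
  (fun i j => esym _ _) (fun i => eirr _) e'conn h_dec hm h0 hB.
set M := vertex_mass p (h \o val : 'I_m.+1 -> R).
have M0 : 0 < M by apply: vertex_mass_gt0; exists ord0; rewrite /= gt_eqF.
have tCB (g : nat -> R) : g m = 0 -> 0 < g 0%N ->
    CB_nonzero (tadpole m.+1 3) (g \o val).
  move=> gm g0; split; last by exists ord0; rewrite /= gt_eqF.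
  by move=> x /(tadpole3_boundary m3) /= ->.
have lambda_le (g : nat -> R) : g m = 0 -> 0 < g 0%N ->
    lambda1p (tadpole m.+1 3) p <=
    tadpole_energy m p g / vertex_mass p (g \o val : 'I_m.+1 -> R).
  move=> gm g0; rewrite -edge_energy_tadpole//.
  exact: lambda1p_le_rayleigh (tCB g gm g0).
have e'_le : edge_energy e' p (h \o val) / M <= rayleigh e p f.
  have -> : edge_energy e' p (h \o val) / M = rayleigh e p (fun x => `|f x|).
    by rewrite -(rayleigh_iso (e1 := e') _ _ bs)// -hE.
  rewrite /rayleigh.
  have -> : vertex_mass p (fun x => `|f x|) = vertex_mass p f.
    by apply: eq_bigr => x _; rewrite normr_id.
  rewrite ler_wpM2r ?edge_energy_norm_le// invr_ge0 ltW// vertex_mass_gt0//.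
  by exists x0.
have t_le : tadpole_energy m p h / M <= rayleigh e p f.
  by apply: le_trans e'_le; rewrite ler_wpM2r// invr_ge0 ltW.
split; first exact: le_trans (lambda_le h hm h0) t_le.
move=> f_le; apply: graph_iso_of_enumeration bs _; apply: E_eq.
  apply: (tadpole_minimizer_decreasing p1 m3 h_dec hm h0) => g gm g0.
  have g_mass : 0 < vertex_mass p (g \o val : 'I_m.+1 -> R).
    by apply: vertex_mass_gt0; exists ord0; rewrite /= gt_eqF.
  have := le_trans t_le (le_trans f_le (lambda_le g gm g0)).
  by rewrite ler_pdivrMr// mulrAC ler_pdivlMr.
have := le_trans e'_le (le_trans f_le (lambda_le h hm h0)).
by rewrite ler_pM2r// invr_gt0.
Qed.

Theorem theorem1p2 (R : realType) (p : R) (hp : 1 < p)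
  (T : finType) (e : rel T)
  (hsym : symmetric e) (hirr : irreflexive e)
  (hconn : forall x y : T, connect e x y)
  (hn : (4 <= #|T|)%N)
  (hB : exists x : T, x \in boundary e) :
  lambda1p (tadpole #|T| 3) p <= lambda1p e p /\
  (lambda1p e p = lambda1p (tadpole #|T| 3) p <-> graph_iso e (tadpole #|T| 3)).
Proof.
have compare (f : T -> R) : CB_nonzero e f ->
    lambda1p (tadpole #|T| 3) p <= rayleigh e p f /\
    (rayleigh e p f <= lambda1p (tadpole #|T| 3) p ->
      graph_iso e (tadpole #|T| 3)).
  move=> fCB.
  have [s bs s_dec] := nonincreasing_enumeration (fun x => `|f x|).
  exact: (tadpole_rayleigh_comparison hp hsym hirr hconn hn hB bs s_dec fCB).
(* Attainment turns equality of the two infima into the premise of the second half of [compare]. *)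
have [f fCB f_min] : exists2 f, CB_nonzero e f & rayleigh e p f = lambda1p e p.
  apply: lambda1p_attained; first exact: lt_trans hp.
  by apply: exists_interior => //; exact: leq_trans hn.
have [f_ge f_eq] := compare f fCB; rewrite -f_min; split=> //; split.
  by move=> f_lambda; apply: f_eq; rewrite f_lambda.
by move=> /lambda1p_iso; rewrite f_min; exact.
Qed.
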